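(* For every pair of integers $k\geq 3$ and $t\geq 3$ there exists a connected graph $H_n$ on $n = k\cdot t$ vertices with minimum degree $\delta(H_n) = \frac{n-k}{k}$ and exactly $k-1$ cut edges.
   Context: All graphs are finite, simple and undirected; a cut edge is an edge whose removal disconnects the graph. *)

(* Defs.v *)
From mathcomp Require Import all_boot all_order all_algebra.

Set Implicit Arguments.
Unset Strict Implicit.
Unset Printing Implicit Defensive.

Record simple_graph (T : finType) := SimpleGraph {
  adj :> rel T;
  adj_sym : symmetric adj;
  adj_irr : irreflexive adj }.

Section Graph.
Variables (T : finType) (G : simple_graph T).
Implicit Types (x y : T) (e : {set T}).

Definition edges : {set {set T}} :=
  [set e | [exists x, exists y, adj G x y && (e == [set x; y])]].

Definition connected : bool := [forall x, forall y, connect (adj G) x y].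

Definition degree x : nat := #|[set y | adj G x y]|.

(* The default #|T| exceeds every degree, so it only matters on the graph
   without vertices. *)
Definition min_degree : nat := \big[minn/#|T|]_x degree x.

Definition delete_rel e : rel T := fun x y => adj G x y && ([set x; y] != e).

Fact delete_rel_sym e : symmetric (delete_rel e).
Proof. by move=> x y; rewrite /delete_rel adj_sym setUC. Qed.

Fact delete_rel_irr e : irreflexive (delete_rel e).
Proof. by move=> x; rewrite /delete_rel adj_irr. Qed.

Definition delete_edge e : simple_graph T :=
  SimpleGraph (delete_rel_sym e) (delete_rel_irr e).

End Graph.

(* Meaningful for connected G: "removal disconnects" is read as "the graph
   obtained by removing e is not connected". *)
Definition cut_edges (T : finType) (G : simple_graph T) : {set {set T}} :=
  [set e in edges G | ~~ connected (delete_edge G e)].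

(* Main.v *)
Require Import Defs.
From mathcomp Require Import all_boot all_order all_algebra.

(** Take [k] disjoint copies of the complete graph on [t] vertices, mark one
    vertex in each copy, and join the marked vertex of one central copy to the
    marked vertices of the [k - 1] others. An unmarked vertex has degree
    [t - 1 = (n - k) / k], the least possible. An edge inside a copy lies in a
    triangle because [t >= 3], hence is not a cut edge; each of the [k - 1]
    joining edges separates its outer copy from the rest. *)

Set Implicit Arguments.
Unset Strict Implicit.
Unset Printing Implicit Defensive.

Section GraphLemmas.
Variables (T : finType) (G : simple_graph T).

Lemma min_degree_eq (d : nat) (x0 : T) :
  (forall x, d <= degree G x) -> degree G x0 = d -> min_degree G = d.
Proof.
move=> ge_d deg_x0; apply/eqP; rewrite eqn_leq; apply/andP; split; last first.
  apply: (big_ind (leq d)) => // [|m n dm dn]; last by rewrite leq_min dm.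
  (* The default [#|T|] of the minimum must also be at least [d]; it bounds the degree of [x0]. *)
  by rewrite -deg_x0 max_card.
rewrite /min_degree; have: x0 \in index_enum T by rewrite mem_index_enum.
elim: (index_enum T) => // y s IHs; rewrite inE big_cons geq_min => /predU1P[<-|].
  by rewrite deg_x0 leqnn.
by move/IHs ->; rewrite orbT.
Qed.

Lemma connected_via (z : T) :
  (forall x, connect (adj G) x z) -> connected G.
Proof.
move=> xz; apply/forallP=> x; apply/forallP=> y.
by apply: connect_trans (xz x) _; rewrite (sym_connect_sym (@adj_sym _ G)).
Qed.

(** The detour through [z] survives the deletion, so it can replace the deleted edge wherever a path
    of [G] uses it. *)
Lemma connected_delete_triangle (x y z : T) :
  connected G -> adj G x z -> adj G z y -> adj G x y ->
  connected (delete_edge G [set x; y]).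
Proof.
move=> /forallP Gconn xz zy xy.
have symD := sym_connect_sym (@adj_sym _ (delete_edge G [set x; y])).
have neq (u v : T) : adj G u v -> u != v.
  by apply: contraTneq => ->; rewrite adj_irr.
have xyD : connect (adj (delete_edge G [set x; y])) x y.
  apply: (connect_trans (y := z)); apply: connect1; rewrite /= /delete_rel.
    rewrite xz; apply: contraTneq (set22 x z) => ->.
    by rewrite !inE negb_or (neq _ _ zy) eq_sym (neq _ _ xz).
  rewrite zy; apply: contraTneq (set21 z y) => ->.
  by rewrite !inE negb_or (neq _ _ zy) eq_sym (neq _ _ xz).
apply/forallP=> u; apply/forallP=> v.
apply: connect_sub (forallP (Gconn u) v) => {u v} u v uv.
have [euv | neuv] := eqVneq [set u; v] [set x; y]; last first.
  by apply: connect1; rewrite /= /delete_rel uv.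
have: u \in [set x; y] by rewrite -euv set21.
have: v \in [set x; y] by rewrite -euv set22.
rewrite !inE => /pred2P[]-> /pred2P[]-> //; by rewrite symD.
Qed.

End GraphLemmas.

Section CliqueStar.
Variables k t : nat.

(** The first coordinate names the copy, the second the vertex in it; [ord0] stands for the central
    copy and for the marked vertex. Both parameters are shifted by one so that [ord0] exists. *)
Definition clique_star_rel : rel ('I_k.+1 * 'I_t.+1) := fun x y =>
  if x.1 == y.1 then x.2 != y.2
  else [&& x.2 == ord0, y.2 == ord0 & (x.1 == ord0) || (y.1 == ord0)].

Fact clique_star_sym : symmetric clique_star_rel.
Proof.
move=> x y; rewrite /clique_star_rel eq_sym; case: ifP => _; first by rewrite eq_sym.
by rewrite andbCA orbC.
Qed.

Fact clique_star_irr : irreflexive clique_star_rel.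
Proof. by move=> x; rewrite /clique_star_rel !eqxx. Qed.

Definition clique_star : simple_graph ('I_k.+1 * 'I_t.+1)%type :=
  SimpleGraph clique_star_sym clique_star_irr.

(** [lift ord0] enumerates the outer copies, so the joining edges are indexed by ['I_k] and counted
    through injectivity. *)
Definition star_edge (j : 'I_k) : {set 'I_k.+1 * 'I_t.+1} :=
  [set (ord0, ord0); (lift ord0 j, ord0)].

Lemma clique_star_connected : connected clique_star.
Proof.
apply: (@connected_via _ _ (ord0, ord0)) => -[i a].
apply: (connect_trans (y := (i, ord0))).
  have [->|na] := eqVneq a ord0; first exact: connect0.
  by apply: connect1; rewrite /= /clique_star_rel /= eqxx.
have [->|ni] := eqVneq i ord0; first exact: connect0.
by apply: connect1; rewrite /= /clique_star_rel /= (negPf ni) eqxx orbT.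
Qed.

Lemma card_clique_neighbours (i : 'I_k.+1) (a : 'I_t.+1) :
  #|[set (i, b) | b in [set~ a]]| = t.
Proof. by rewrite card_imset ?cardsC1 ?card_ord // => b c []. Qed.

Lemma degree_clique_star_ge (x : 'I_k.+1 * 'I_t.+1) : t <= degree clique_star x.
Proof.
case: x => i a; rewrite -{1}(card_clique_neighbours i a); apply: subset_leq_card.
apply/subsetP=> _ /imsetP[b + ->]; rewrite !inE /= /clique_star_rel /= eqxx.
by rewrite eq_sym.
Qed.

Lemma degree_clique_star_unmarked (i : 'I_k.+1) (a : 'I_t.+1) :
  a != ord0 -> degree clique_star (i, a) = t.
Proof.
move=> na; rewrite -[RHS](card_clique_neighbours i a); congr #|pred_of_set _|.
apply/setP=> -[j b]; rewrite !inE /= /clique_star_rel /= (negPf na) /=.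
apply/idP/imsetP => [|[c]]; last first.
  by rewrite !inE eq_sym => ? [-> ->]; rewrite eqxx.
by case: eqP => // -> nab; exists b; rewrite // !inE eq_sym.
Qed.

Lemma min_degree_clique_star : 0 < t -> min_degree clique_star = t.
Proof.
(* Since [t] is positive, [ord_max] differs from [ord0] and gives an unmarked vertex. *)
move=> t_gt0; apply: (@min_degree_eq _ _ _ (ord0, ord_max)).
  exact: degree_clique_star_ge.
by apply: degree_clique_star_unmarked; rewrite -val_eqE /= -lt0n.
Qed.

Lemma star_edge_inj : injective star_edge.
Proof.
move=> i j eij; have: (lift ord0 i, ord0) \in star_edge j by rewrite -eij set22.
by rewrite !inE !xpair_eqE /= andbT => /eqP/lift_inj.
Qed.

Lemma star_edge_in_edges (j : 'I_k) : star_edge j \in edges clique_star.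
Proof.
rewrite inE; apply/existsP; exists (ord0, ord0); apply/existsP.
by exists (lift ord0 j, ord0); rewrite eqxx andbT.
Qed.

Lemma star_edge_disconnects (j : 'I_k) :
  ~~ connected (delete_edge clique_star (star_edge j)).
Proof.
set D := delete_edge _ _; set i := lift ord0 j.
(* The outer copy [i] is a union of components once its edge is removed. *)
have clD : fingraph.closed (adj D) [pred x : 'I_k.+1 * 'I_t.+1 | x.1 == i].
  apply: (intro_closed (sym_connect_sym (@adj_sym _ D))) => -[p a] [q b].
  rewrite /= /delete_rel /= /clique_star_rel inE /= => /andP[+ ne] /eqP pi.
  move: ne; rewrite {p}pi inE /= [i == q]eq_sym; case: (q =P i) => //= _ ne.
  (* An edge leaving the outer copy [i] joins marked vertices and must end in the central copy, so
     it is the deleted one. *)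
  case/and3P=> /eqP a0 /eqP b0 /eqP q0; case/eqP: ne.
  by rewrite a0 b0 q0 setUC.
apply/negP=> /forallP/(_ (i, ord0))/forallP/(_ (ord0, ord0)).
by move/(closed_connect clD); rewrite !inE /= eqxx.
Qed.

Lemma cut_edges_clique_star :
  1 < t -> cut_edges clique_star = [set star_edge j | j : 'I_k].
Proof.
move=> t_gt1; apply/setP=> e; rewrite inE; apply/andP/imsetP => [[]|[j _ ->]]; last first.
  by rewrite star_edge_in_edges star_edge_disconnects.
rewrite inE => /existsP[[i a] /existsP[[j b] /andP[adjxy /eqP->]]].
have [eij | nij] := eqVneq i j.
  (* A copy has [t.+1 > 2] vertices, so some third vertex [c] completes a triangle on the edge. *)
  subst j; have [c] : exists c, c \in ~: [set a; b].
    apply/set0Pn; rewrite -card_gt0 cardsCs setCK card_ord subn_gt0.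
    by rewrite cards2 ltnS; apply: leq_trans t_gt1; case: (a != b).
  rewrite !inE negb_or => /andP[ca cb] /negP[].
  apply: (@connected_delete_triangle _ _ _ _ (i, c)) => //.
  - exact: clique_star_connected.
  - by rewrite /= /clique_star_rel /= eqxx eq_sym.
  - by rewrite /= /clique_star_rel /= eqxx.
move=> _; move: adjxy; rewrite /= /clique_star_rel /= (negPf nij).
case/and3P=> /eqP-> /eqP-> /pred2P.
(* Either end may lie in the central copy; the other copy is then nonzero, hence some
   [lift ord0 l]. *)
have [i0 | ni] := eqVneq i ord0; rewrite ?i0 in nij *.
  by move=> _; case/unlift_some: nij => l -> _; exists l.
case=> [/eqP|j0]; first by rewrite (negPf ni).
by rewrite j0; rewrite eq_sym in ni; case/unlift_some: ni => l -> _; exists l; rewrite // setUC.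
Qed.

End CliqueStar.

Theorem theorem3p2 (k t n : nat) (hk : 3 <= k) (ht : 3 <= t) (hn : n = k * t) :
  exists (T : finType) (H : simple_graph T),
    [/\ #|T| = n,
        connected H,
        ((min_degree H)%:R = (n%:R - k%:R) / k%:R :> rat)%R
      & #|cut_edges H| = k - 1].
Proof.
case: k t hk ht hn => [//|k] [//|t] _ ht ->.
exists ('I_k.+1 * 'I_t.+1)%type, (clique_star k t); split.
- by rewrite card_prod !card_ord.
- exact: clique_star_connected.
- rewrite min_degree_clique_star; last exact: (@ltnW 1 t).
  (* In the shifted parameters the numerator is [k.+1 * t.+1 - k.+1 = k.+1 * t]. *)
  rewrite mulnS GRing.natrD GRing.addrC GRing.addKr GRing.natrM GRing.mulrC.
  by rewrite GRing.mulKf // Num.Theory.pnatr_eq0.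
- by rewrite cut_edges_clique_star // card_imset ?card_ord ?subn1 //; apply: star_edge_inj.
Qed.
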